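(* For every $L>0$, $R\geq 0$, and integer $d\geq 1$, $$W_1(L,R,d)=\frac{L^2R^2}{4},$$ where $$W_1(L,R,d):=\sup_{\substack{f\in\mathcal{F}_{0,L}(\mathbb{R}^d),\ x_\star\in\arg\min f\\ x_0\in\mathbb{R}^d,\ \lVert x_0-x_\star\rVert\leq R}}\ \min_{0\leq k\leq 1}\lVert\nabla f(x_k)\rVert^2$$ and $x_0,x_1$ are the first two query points of Nesterov's fast gradient method (FGM, as defined in the context).
   Context: $\mathcal{F}_{0,L}(\mathbb{R}^d)$ is the class of convex differentiable functions $f:\mathbb{R}^d\to\mathbb{R}$ whose gradient is $L$-Lipschitz with respect to the Euclidean norm. The scalars $t_k$ are defined by $t_0=1$ and $t_{k+1}=\bigl(1+\sqrt{1+4t_k^2}\bigr)/2$. FGM applied to $f$ from $x_0$: set $y_0=x_0$ and, for $k\geq 0$, $y_{k+1}=x_k-\frac1L\nabla f(x_k)$ and $x_{k+1}=y_{k+1}+\frac{t_k-1}{t_{k+1}}(y_{k+1}-y_k)$. *)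

(* Defs.v *)
From HB Require Import structures.
From mathcomp Require Import all_boot all_order all_algebra.
From mathcomp Require Import all_classical all_reals all_analysis.

Set Implicit Arguments.
Unset Strict Implicit.
Unset Printing Implicit Defensive.

Import Order.TTheory GRing.Theory Num.Theory.
Import numFieldNormedType.Exports.

Local Open Scope classical_set_scope.
Local Open Scope ring_scope.

(* The library's norm on ['rV[R]_d] is the max norm, so the Euclidean norm is
   defined here. The topology, and hence [differentiable], is that of the max
   norm; it agrees with the Euclidean one in finite dimension. *)
Definition enorm (R : realType) (d : nat) (u : 'rV[R]_d) : R :=
  Num.sqrt (\sum_(i < d) u 0 i ^+ 2).

Definition grad (R : realType) (d : nat) (f : 'rV[R]_d -> R) (x : 'rV[R]_d) :
    'rV[R]_d :=
  \row_(i < d) 'D_(delta_mx 0 i) f x.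

Definition smooth_convex (R : realType) (d : nat) (L : R)
    (f : 'rV[R]_d -> R) : Prop :=
  [/\ convex_function [set: 'rV[R]_d] f,
      forall x, differentiable f x
    & forall x y, enorm (grad f x - grad f y) <= L * enorm (x - y)].

Definition argmin (R : realType) (d : nat) (f : 'rV[R]_d -> R) :
    set 'rV[R]_d :=
  [set xs | forall x, f xs <= f x].

Fixpoint fgm_t (R : realType) (k : nat) : R :=
  if k is k'.+1 then (1 + Num.sqrt (1 + 4 * fgm_t R k' ^+ 2)) / 2 else 1.

(* [fgm L f x0 k] is the pair (x_k, y_k). *)
Fixpoint fgm (R : realType) (d : nat) (L : R) (f : 'rV[R]_d -> R)
    (x0 : 'rV[R]_d) (k : nat) : 'rV[R]_d * 'rV[R]_d :=
  if k is k'.+1 then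
    let: (x, y) := fgm L f x0 k' in
    let y' := x - L^-1 *: grad f x in
    (y' + ((fgm_t R k' - 1) / fgm_t R k'.+1) *: (y' - y), y')
  else (x0, x0).

Definition fgm_x (R : realType) (d : nat) (L : R) (f : 'rV[R]_d -> R)
    (x0 : 'rV[R]_d) (k : nat) : 'rV[R]_d := (fgm L f x0 k).1.

Definition min_grad_sq (R : realType) (d : nat) (N : nat) (L : R)
    (f : 'rV[R]_d -> R) (x0 : 'rV[R]_d) : \bar R :=
  \big[Order.min/+oo%E]_(k < N.+1) (enorm (grad f (fgm_x L f x0 k)) ^+ 2)%:E.

(* W_N(L, r, d). The supremum is taken in the extended reals, so that its
   finiteness is part of any claim about its value. *)
Definition worst_case (R : realType) (N : nat) (L r : R) (d : nat) : \bar R :=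
  ereal_sup [set w | exists (f : 'rV[R]_d -> R) (xs x0 : 'rV[R]_d),
    [/\ smooth_convex L f, argmin f xs, enorm (x0 - xs) <= r
      & w = min_grad_sq N L f x0]].

(* Main.v *)
Require Import Defs.
From mathcomp Require Import all_boot all_order all_algebra.
From mathcomp Require Import all_classical all_reals all_analysis.
From mathcomp Require Import ring lra.

Import Order.TTheory GRing.Theory Num.Theory.
Import numFieldNormedType.Exports.

Local Open Scope ring_scope.

(** Since [t_0 = 1], the momentum term of the first step vanishes, so
    [x1 = x0 - L^-1 g0] is a plain gradient step; write [g0], [g1] for the
    gradients at [x0], [x1].

    Upper bound. The gradient of a smooth convex function satisfies
    [f x + <grad f x, y - x> + |grad f y - grad f x|^2 / (2 L) <= f y]
    ([cocoercive_ineq]). Adding its instances for [(x1, x0)], [(x0, xs)] and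
    [(xs, x1)], where [grad f xs = 0], cancels all function values, and because
    [x0 - x1 = L^-1 g0] the terms in [<g0, g1>] cancel as well, leaving
    [|g0|^2 + |g1|^2 <= L <g0, x0 - xs> <= L r |g0|].
    Completing the square in [|g0|] gives [|g1|^2 <= (L r / 2)^2], whatever [g0]
    is ([gradient_step_bound]).

    Lower bound. Take [f] to be the (one-sided) Huber function of one
    coordinate, quadratic with curvature [L] up to [c = r / 2] and affine with
    slope [L c] beyond, minimised at [0], and start at distance [r] from [0] in
    the affine part. The step has length [c], so [x1] sits at the junction
    [r - c = c], where the slope is still [L c]: both gradients have norm
    [L r / 2]. *)

(** * Euclidean inner product and norm *)

Definition dotv {R : realType} {d : nat} (u v : 'rV[R]_d) : R :=
  \sum_(i < d) u 0 i * v 0 i.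

Section InnerProduct.
Context {R : realType} {d : nat}.
Implicit Types (u v w : 'rV[R]_d) (a : R).

Lemma dotvC u v : dotv u v = dotv v u.
Proof. by apply: eq_bigr => i _; rewrite mulrC. Qed.

Lemma dotvDl u v w : dotv (u + v) w = dotv u w + dotv v w.
Proof. by rewrite -big_split; apply: eq_bigr => i _; rewrite mxE mulrDl. Qed.

Lemma dotvZl a u w : dotv (a *: u) w = a * dotv u w.
Proof. by rewrite mulr_sumr; apply: eq_bigr => i _; rewrite mxE mulrA. Qed.

Lemma dotvDr u v w : dotv w (u + v) = dotv w u + dotv w v.
Proof. by rewrite dotvC dotvDl !(dotvC w). Qed.

Lemma dotvZr a u w : dotv w (a *: u) = a * dotv w u.
Proof. by rewrite dotvC dotvZl dotvC. Qed.

Lemma dotvNl u w : dotv (- u) w = - dotv u w.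
Proof. by rewrite -scaleN1r dotvZl mulN1r. Qed.

Lemma dotvNr u w : dotv w (- u) = - dotv w u.
Proof. by rewrite dotvC dotvNl dotvC. Qed.

Definition dotvE := (dotvDl, dotvDr, dotvNl, dotvNr, dotvZl, dotvZr).

Lemma dotvv_ge0 u : 0 <= dotv u u.
Proof. by apply: sumr_ge0 => i _; rewrite -expr2 sqr_ge0. Qed.

Lemma dotvv_eq0 u : dotv u u = 0 -> u = 0.
Proof.
move=> /eqP; rewrite psumr_eq0 => [/allP u0|i _]; last by rewrite -expr2 sqr_ge0.
apply/rowP => i; rewrite mxE; apply/eqP.
by have := u0 i (mem_index_enum i); rewrite /= -expr2 sqrf_eq0.
Qed.

Lemma enorm_sqr u : enorm u ^+ 2 = dotv u u.
Proof.
have E : \sum_(i < d) u 0 i ^+ 2 = dotv u u.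
  by apply: eq_bigr => i _; rewrite expr2.
by rewrite /enorm E sqr_sqrtr// dotvv_ge0.
Qed.

Lemma enorm_ge0 u : 0 <= enorm u.
Proof. exact: sqrtr_ge0. Qed.

Lemma enormZ a u : enorm (a *: u) = `|a| * enorm u.
Proof.
apply/eqP; rewrite -(@eqrXn2 _ 2) ?mulr_ge0 ?enorm_ge0//.
by rewrite exprMn !enorm_sqr !dotvE real_normK ?num_real// expr2 mulrA.
Qed.

Lemma enormN u : enorm (- u) = enorm u.
Proof. by rewrite /enorm; under eq_bigr do rewrite mxE sqrrN. Qed.

(** The discriminant argument: expand [|<v, v> u - <u, v> v|^2 >= 0]. *)
Lemma cauchy_schwarz u v : dotv u v <= enorm u * enorm v.
Proof.
have [->|v0] := eqVneq v 0.
  by rewrite -[0](scale0r 0) dotvZr enormZ normr0 !mul0r mulr0.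
have v_gt0 : 0 < dotv v v.
  by rewrite lt_neqAle dotvv_ge0 andbT eq_sym; apply: contra_neq v0 => /dotvv_eq0.
rewrite (le_trans (ler_norm _))// -(@ler_pXn2r _ 2) ?nnegrE ?mulr_ge0 ?enorm_ge0//.
rewrite real_normK ?num_real// exprMn !enorm_sqr.
have := dotvv_ge0 (dotv v v *: u - dotv u v *: v).
rewrite !dotvE (dotvC v u) => h.
rewrite -subr_ge0 -(pmulr_rge0 _ v_gt0); lra.
Qed.

Lemma enorm_delta (i : 'I_d) : enorm (delta_mx 0 i : 'rV[R]_d) = 1.
Proof.
rewrite /enorm (bigD1 i)//= big1 ?addr0 => [|j /negbTE ji].
  by rewrite mxE !eqxx expr1n sqrtr1.
by rewrite mxE ji andbF expr0n.
Qed.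

Lemma coord_le_enorm u (i : 'I_d) : `|u 0 i| <= enorm u.
Proof.
rewrite -sqrtr_sqr ler_sqrt ?sumr_ge0// => [|j _]; last exact: sqr_ge0.
by rewrite (bigD1 i)//= lerDl sumr_ge0// => j _; rewrite sqr_ge0.
Qed.

End InnerProduct.

(** * Derivatives along lines *)

Section SmoothConvex.
Context {R : realType} {d : nat}.
Implicit Types (f : 'rV[R]_d -> R) (x y v : 'rV[R]_d) (t : R).

Lemma diff_dotv f x v : differentiable f x -> 'd f x v = dotv (grad f x) v.
Proof.
move=> df; rewrite {1}[v]row_sum_delta linear_sum /=.
apply: eq_bigr => i _.
by rewrite linearZ/= mxE deriveE// mulrC.
Qed.

(** Reduces the smooth convex inequalities to one real variable. *)
Lemma is_derive_line f x v t : (forall z, differentiable f z) ->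
  is_derive t 1 (fun s => f (x + s *: v)) (dotv (grad f (x + t *: v)) v).
Proof.
move=> df.
have dl : is_diff t (fun s : R => x + s *: v) ( *:%R^~ v).
  by apply: is_diff_eq; rewrite add0r.
have dc : differentiable (f \o (fun s : R => x + s *: v)) t.
  exact: differentiable_comp.
apply: DeriveDef; first exact/derivable1_diffP.
rewrite deriveE// diff_comp//= diff_val/= scale1r.
exact: diff_dotv.
Qed.

End SmoothConvex.

(** * Inequalities for smooth convex functions *)

Section SmoothConvexInequalities.
Context {R : realType} {d : nat} {L : R} {f : 'rV[R]_d -> R}.
Hypotheses (L_gt0 : 0 < L) (smooth_f : smooth_convex L f).
Implicit Types (x y v : 'rV[R]_d) (t : R).

Lemma grad_variation x v t : 0 <= t ->
  `|dotv (grad f (x + t *: v)) v - dotv (grad f x) v| <= L * t * enorm v ^+ 2.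
Proof.
move=> t_ge0; case: smooth_f => _ _ lip.
have key (g h : 'rV[R]_d) : enorm (g - h) <= L * t * enorm v ->
    dotv g v - dotv h v <= L * t * enorm v ^+ 2.
  move=> gh; rewrite -dotvNl -dotvDl (le_trans (cauchy_schwarz _ _))//.
  by rewrite expr2 mulrA ler_wpM2r ?enorm_ge0.
have tv : enorm (t *: v) = t * enorm v by rewrite enormZ ger0_norm.
rewrite ler_norml lerNl opprB !key// -mulrA -tv.
  by apply: (le_trans (lip _ _)); rewrite addrC addKr.
by apply: (le_trans (lip _ _)); rewrite opprD addrA subrr sub0r enormN.
Qed.

(** For [0 < t <= 1] the chord slope [(f (x + t v) - f x) / t] is at most
    [f y - f x] by convexity, and equals the directional derivative at some
    [x + c v] with [0 < c < t] by the mean value theorem; that derivative differs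
    from the one at [x] by [O(t)], and [t] is arbitrary. *)
Lemma gradient_ineq x y : f x + dotv (grad f x) (y - x) <= f y.
Proof.
have [cvx df _] := smooth_f.
set v := y - x; set K := L * enorm v ^+ 2.
have K_ge0 : 0 <= K by rewrite mulr_ge0 ?sqr_ge0// ltW.
suff small t : 0 < t -> t <= 1 -> dotv (grad f x) v <= f y - f x + t * K.
  apply/ler_addgt0Pl => e e0.
  pose t := Num.min 1 (e / (K + 1)).
  have t_gt0 : 0 < t by rewrite lt_min ltr01 divr_gt0// ltr_wpDl.
  have t_le1 : t <= 1 by rewrite ge_min lexx.
  have tK : t * (K + 1) <= e.
    by rewrite -ler_pdivlMr ?ltr_wpDl// ge_min lexx orbT.
  have := small t t_gt0 t_le1; lra.
move=> t_gt0 t_le1.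
pose phi (s : R) := f (x + s *: v).
have dphi (s : R) : is_derive s 1 phi (dotv (grad f (x + s *: v)) v).
  exact: is_derive_line.
have [|c /[!in_itv]/= /andP[c_gt0 c_lt] fE] := MVT t_gt0 (fun s _ => dphi s).
  by apply: derivable_within_continuous => s _; have [] := dphi s.
have chord : f (x + t *: v) <= (1 - t) * f x + t * f y.
  have conv_le : f (t *: y + (1 - t) *: x) <= t * f y + (1 - t) * f x.
    by apply: (cvx (Itv01 (ltW t_gt0) t_le1) y x); rewrite in_setT.
  rewrite [leRHS]addrC (_ : x + t *: v = t *: y + (1 - t) *: x)//.
  by rewrite /v scalerBr scalerBl scale1r addrCA.
have slope : dotv (grad f (x + c *: v)) v <= f y - f x.
  rewrite -(ler_pM2r t_gt0); move: fE; rewrite /phi scale0r addr0 subr0 => <-; lra.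
have := grad_variation x v c (ltW c_gt0); rewrite ler_norml => /andP[+ _].
have : c * K <= t * K by rewrite ler_wpM2r// ltW.
rewrite /K; lra.
Qed.

(** The function [psi] below subtracts from [f] along the line its first-order
    part and the quadratic term; [grad_variation] makes its derivative
    nonpositive for positive arguments. *)
Lemma descent_ineq x v : f (x + v) <= f x + dotv (grad f x) v + L / 2 * dotv v v.
Proof.
have [_ df _] := smooth_f.
set a := dotv (grad f x) v; set b := L / 2 * dotv v v.
pose psi (s : R) := f (x + s *: v) - s * a - s ^+ 2 * b.
pose dpsi (s : R) := dotv (grad f (x + s *: v)) v - a - 2 * s * b.
have dpsiP (s : R) : is_derive s 1 psi (dpsi s).
  have ? := is_derive_line f x v s df.
  apply: is_derive_eq.
  by rewrite /dpsi /GRing.scale/=; ring.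
have [|c /[!in_itv]/= /andP[c_gt0 _]] := MVT ltr01 (fun s _ => dpsiP s).
  by apply: derivable_within_continuous => s _; have [] := dpsiP s.
rewrite /psi scale1r scale0r addr0.
have := grad_variation x v c (ltW c_gt0); rewrite ler_norml => /andP[_].
rewrite -/a enorm_sqr /dpsi /b; lra.
Qed.

(** Both sides are compared with the value of [f] at [y - L^-1 g], where
    [g = grad f y - grad f x]: that point minimises over [z] the gap between
    the quadratic upper bound at [y] and the linear lower bound at [x]. *)
Lemma cocoercive_ineq x y :
  f x + dotv (grad f x) (y - x) +
    (2 * L)^-1 * dotv (grad f y - grad f x) (grad f y - grad f x) <= f y.
Proof.
move gE : (grad f y - grad f x) => g.
have h1 := gradient_ineq x (y - L^-1 *: g).
have h2 := descent_ineq y (- (L^-1 *: g)).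
move: h1 h2; rewrite !dotvE.
have -> : dotv (grad f y) g = dotv g g + dotv (grad f x) g.
  by rewrite -dotvDl -gE subrK.
have -> : L / 2 * - (- (L^-1 * (L^-1 * dotv g g))) = L^-1 * dotv g g / 2.
  by field; rewrite gt_eqF.
rewrite invfM; lra.
Qed.

(** A gradient step from [xs] would decrease [f] by [|grad f xs|^2 / (2 L)]. *)
Lemma grad_argmin xs : argmin f xs -> grad f xs = 0.
Proof.
move=> /(_ (xs - L^-1 *: grad f xs)) min_xs.
apply: dotvv_eq0; apply/eqP; rewrite eq_le dotvv_ge0 andbT.
have := le_trans min_xs (descent_ineq xs (- (L^-1 *: grad f xs))).
rewrite !dotvNr dotvNl !dotvZr dotvZl.
set q := dotv _ _.
have -> : L / 2 * - (- (L^-1 * (L^-1 * q))) = L^-1 * q / 2.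
  by field; rewrite gt_eqF.
move=> h; have Lq_le0 : L^-1 * q <= 0 by lra.
by rewrite pmulr_rle0 ?invr_gt0 in Lq_le0.
Qed.

(** The three instances of [cocoercive_ineq] add up to [sum_dotv]; no case
    distinction on which of the two gradients is smaller is involved. *)
Lemma gradient_step_bound (r : R) xs x0 :
  argmin f xs -> enorm (x0 - xs) <= r ->
  enorm (grad f (x0 - L^-1 *: grad f x0)) ^+ 2 <= L ^+ 2 * r ^+ 2 / 4.
Proof.
move=> min_xs; set x1 := x0 - L^-1 *: _.
have i10 := cocoercive_ineq x1 x0.
have i0s := cocoercive_ineq x0 xs.
have is1 := cocoercive_ineq xs x1.
have x01 : x0 - x1 = L^-1 *: grad f x0 by rewrite /x1 opprB addrC subrK.
move: i10 i0s is1; rewrite x01 (grad_argmin xs)// -(opprB x0 xs).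
move: (grad f x0) (grad f x1) (x0 - xs) => g0 g1 v.
rewrite subr0 sub0r -[in dotv 0 _](scale0r 0) !dotvE (dotvC g1 g0) invfM.
move=> i10 i0s is1 v_le.
have sum_dotv : L^-1 * (dotv g0 g0 + dotv g1 g1) <= dotv g0 v by lra.
have sum_sqr : enorm g0 ^+ 2 + enorm g1 ^+ 2 <= L * (enorm g0 * r).
  rewrite -ler_pdivrMl// !enorm_sqr (le_trans sum_dotv)//.
  by rewrite (le_trans (cauchy_schwarz _ _))// ler_wpM2l// enorm_ge0.
(* [L r a - a^2] is at most [(L r / 2)^2], attained at [a = L r / 2]. *)
have := sqr_ge0 (enorm g0 - L * r / 2); lra.
Qed.

End SmoothConvexInequalities.

(** * The Huber function *)

Section Huber.
Local Open Scope classical_set_scope.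
Local Open Scope ring_scope.
Context {R : realType} (L c : R).
Hypothesis L_gt0 : 0 < L.
Implicit Types s t : R.

(** Subtracting the squared excess over [c] turns the parabola into its tangent
    line at [c] beyond [c], without a case distinction. *)
Definition huber s : R := L / 2 * (s ^+ 2 - Num.max (s - c) 0 ^+ 2).

Definition huber' s : R := L * Num.min s c.

(** These two bounds on the Bregman divergence serve twice: the lower one is convexity, and together they squeeze the difference
    quotient, hence differentiability. *)
Lemma huber_bregman s t :
  0 <= huber t - huber s - huber' s * (t - s) <= L / 2 * (t - s) ^+ 2.
Proof.
have -> : huber t - huber s - huber' s * (t - s) =
    L / 2 * (t ^+ 2 - Num.max (t - c) 0 ^+ 2 - (s ^+ 2 - Num.max (s - c) 0 ^+ 2)
             - 2 * Num.min s c * (t - s)).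
  by rewrite /huber /huber'; lra.
rewrite pmulr_rge0 ?divr_gt0// ler_pM2l ?divr_gt0//.
have sq (a : R) : 0 <= a ^+ 2 := sqr_ge0 a.
have below (a : R) : a <= c -> Num.max (a - c) 0 = 0.
  by move=> ac; rewrite max_r// subr_le0.
have above (a : R) : c < a -> Num.max (a - c) 0 = a - c.
  by move=> ca; rewrite max_l// subr_ge0 ltW.
have [tc|tc] := leP t c; have [sc|sc] := leP s c.
- rewrite !below//; apply/andP; split; have := sq (t - s); lra.
- rewrite below// above//.
  (* The product is [(t - s)^2 - (t - c)^2]. *)
  have : 0 <= (s - c) * (s - c + 2 * (c - t)) by apply: mulr_ge0; lra.
  by move=> ?; apply/andP; split; have := sq (t - c); lra.
- rewrite above// below//.
  (* The product is [(t - s)^2 - (t - c)^2], the divergence itself up to the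
     factor [L / 2]. *)
  have : 0 <= (c - s) * (t - c + (t - s)) by apply: mulr_ge0; lra.
  by move=> ?; apply/andP; split; have := sq (t - c); lra.
- rewrite !above//; apply/andP; split; have := sq (t - s); lra.
Qed.

Lemma is_derive_huber s : is_derive s 1 huber (huber' s).
Proof.
have quot_cvg : h^-1 *: ((huber \o shift s) (h *: 1) - huber s) @[h --> 0^']
    --> huber' s.
  apply/cvgrPdist_le => e e_gt0; near=> h.
  have h_neq0 : h != 0 by near: h; exact: nbhs_dnbhs_neq.
  have h_small : `|h| <= e / L.
    by near: h; apply: dnbhs0_le; exact: divr_gt0.
  have [lo up] := andP (huber_bregman s (h + s)); rewrite addrK in lo up.
  set D := huber (h + s) - huber s - huber' s * h in lo up.
  rewrite (_ : _ - _ = - (h^-1 * D)); last first.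
    by rewrite /D /GRing.scale/= mulr1; field.
  rewrite normrN normrM normfV (ger0_norm lo) ler_pdivrMl ?normr_gt0//.
  rewrite (le_trans up)// -[h ^+ 2]real_normK ?num_real//.
  have : `|h| * `|h| * L <= `|h| * e.
    by rewrite -mulrA ler_wpM2l// -ler_pdivlMr.
  have : 0 <= L * `|h| ^+ 2 by rewrite mulr_ge0 ?sqr_ge0// ltW.
  lra.
apply: DeriveDef; first by apply/cvg_ex; exists (huber' s).
exact: cvg_lim quot_cvg.
Unshelve. all: by end_near. Qed.

Lemma huber'_lipschitz s t : `|huber' s - huber' t| <= L * `|s - t|.
Proof.
rewrite /huber' -mulrBr normrM gtr0_norm// ler_pM2l//.
wlog st : s t / s <= t => [th|].
  by have [/th//|/ltW/th] := leP s t; rewrite distrC (distrC t).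
rewrite !ler0_norm ?subr_le0//; last by rewrite le_min2.
have [|] := leP s c; have [|] := leP t c; lra.
Qed.

End Huber.

(** * The Huber function of one coordinate *)

Section HuberCoordinate.
Context {R : realType} {d : nat} (L c : R) (i0 : 'I_d).
Hypothesis L_gt0 : 0 < L.
Implicit Types x y : 'rV[R]_d.

Definition huber_coord x : R := huber L c (x 0 i0).

Lemma differentiable_huber_coord x : differentiable huber_coord x.
Proof.
apply: (@differentiable_comp _ _ _ _ (fun z : 'rV[R]_d => z 0 i0 : R) (huber L c)).
  exact: differentiable_coord.
by apply/derivable1_diffP; have [] := is_derive_huber L c L_gt0 (x 0 i0).
Qed.

(** Moving in direction [v] moves the selected coordinate at speed [v 0 i0], so
    a directional derivative of [huber_coord] is one of [huber]. *)
Lemma grad_huber_coord x :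
  grad huber_coord x = huber' L c (x 0 i0) *: delta_mx 0 i0.
Proof.
have dh := is_derive_huber L c L_gt0 (x 0 i0).
have deriveC (v : 'rV[R]_d) :
    'D_v huber_coord x = 'D_(v 0 i0) (huber L c) (x 0 i0).
  rewrite /derive; set p := (fun h => _); set q := (fun h => _).
  suff -> : p = q by [].
  by apply/funext => h; rewrite /p /q /huber_coord /= !mxE.
apply/rowP => i; rewrite !mxE deriveC mxE eqxx eq_sym /=.
have [_|_] := eqVneq i0 i; first by rewrite derive_val mulr1.
by rewrite derive0 mulr0.
Qed.

Lemma smooth_convex_huber_coord : smooth_convex L huber_coord.
Proof.
split.
- move=> t x y _ _; rewrite /huber_coord.
  have t_ge0 : 0 <= t%:num by [].
  have t_le1 : 0 <= 1 - t%:num by rewrite subr_ge0.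
  have -> : (conv t x y : 'rV[R]_d) 0 i0 = t%:num * x 0 i0 + (1 - t%:num) * y 0 i0.
    by rewrite /conv/= !mxE.
  (* Average, with weights [t] and [1 - t], the tangent-line inequalities at
     the convex combination [z]. *)
  set z := (X in huber L c X <= _).
  have /andP[/(mulr_ge0 t_ge0) bx _] := huber_bregman L c L_gt0 z (x 0 i0).
  have /andP[/(mulr_ge0 t_le1) by_ _] := huber_bregman L c L_gt0 z (y 0 i0).
  have : huber' L c z * (t%:num * x 0 i0 + (1 - t%:num) * y 0 i0 - z) = 0.
    by rewrite subrr mulr0.
  move: bx by_; move: (huber' L c z) => s; rewrite convRE.
  by rewrite -[unstable.onem _]/(1 - t%:num); lra.
- exact: differentiable_huber_coord.
- move=> x y; rewrite !grad_huber_coord -scalerBl enormZ enorm_delta mulr1.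
  rewrite (le_trans (huber'_lipschitz _ _ _ _ _))//.
  rewrite ler_pM2l//; have := coord_le_enorm (x - y) i0.
  by rewrite !mxE.
Qed.

Lemma argmin_huber_coord : 0 <= c -> argmin huber_coord 0.
Proof.
move=> c_ge0 x; have /andP[+ _] := huber_bregman L c L_gt0 0 (x 0 i0).
by rewrite /huber_coord mxE /huber' min_l// mulr0 mul0r subr0 subr_ge0.
Qed.

End HuberCoordinate.

(** * The first step of the method *)

Section FirstIterates.
Context {R : realType} {d : nat}.

Lemma fgm_x1 (L : R) (f : 'rV[R]_d -> R) x0 :
  fgm_x L f x0 1 = x0 - L^-1 *: grad f x0.
Proof. by rewrite /fgm_x /= subrr mul0r scale0r addr0. Qed.

Lemma min_grad_sq1 (L : R) (f : 'rV[R]_d -> R) x0 :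
  min_grad_sq 1 L f x0 =
  (Num.min (enorm (grad f x0) ^+ 2)
           (enorm (grad f (x0 - L^-1 *: grad f x0)) ^+ 2))%:E.
Proof.
rewrite /min_grad_sq !big_ord_recl big_ord0 -fgm_x1 EFin_min.
by rewrite [X in Order.min _ X]min_l ?leey.
Qed.

End FirstIterates.

Theorem proposition8p1 (R : realType) (L r : R) (d : nat)
    (hL : 0 < L) (hr : 0 <= r) (hd : (1 <= d)%N) :
  worst_case 1 L r d = (L ^+ 2 * r ^+ 2 / 4)%:E.
Proof.
apply/eqP; rewrite eq_le; apply/andP; split.
  apply: ge_ereal_sup => _ [f [xs [x0 [smooth_f min_xs dist_r ->]]]].
  rewrite min_grad_sq1 lee_fin ge_min.
  by rewrite (gradient_step_bound hL smooth_f r xs x0 min_xs dist_r) orbT.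
pose i0 : 'I_d := Ordinal hd.
pose c := r / 2.
have c_ge0 : 0 <= c by rewrite divr_ge0.
apply: ereal_sup_ubound; exists (huber_coord L c i0), 0, (r *: delta_mx 0 i0).
split.
- exact: smooth_convex_huber_coord.
- exact: argmin_huber_coord.
- by rewrite subr0 enormZ enorm_delta mulr1 ger0_norm.
rewrite min_grad_sq1 !grad_huber_coord// !mxE !eqxx !mulr1.
have -> : huber' L c r = L * c by rewrite /huber' min_r// /c; lra.
rewrite mulKf ?gt_eqF//.
have -> : huber' L c (r - c) = L * c by rewrite /huber' min_r// /c; lra.
rewrite minxx enormZ enorm_delta mulr1 real_normK ?num_real//; congr (_%:E).
by rewrite /c; field.
Qed.
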